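(* Let $n\geq 3$, let $q$ be a prime power, consider $\mathrm{GF}(q^n)$, and let $e=(q^n-1)/(q-1)$ and $f=q-1$. Let $\alpha$ be a primitive element of $\mathrm{GF}(q^n)$ and let $I$ be a corresponding Singer difference set in $\mathbb{Z}_e$. Let $1\leq k\leq e-1$. Then, as multisets, $$\Delta(C_k^e,C_0^e)=\bigcup_{j\in S_k\setminus\{0,k\}}C_j^e,$$ where $S_k$ is characterized as follows: (i) if $\alpha^k$ does not lie in a proper subfield $\mathrm{GF}(q^d)$ ($d\mid n$, $d<n$) of $\mathrm{GF}(q^n)$, then $$S_k=-x+\Big(\bigcap_{i=0}^{n-3}(-ik+I)\Big),$$ where $x$ is the element of $\Big(\bigcap_{i=0}^{n-3}(-ik+I)\Big)\cap\Big(-k+\bigcap_{i=0}^{n-3}(-ik+I)\Big)$; (ii) if $\alpha^k=\alpha^{y(q^n-1)/(q^d-1)}$ lies in $\mathrm{GF}(q^d)$ ($d>1$, $d\mid n$), then $$S_k=\left(\frac{q^n-1}{q^d-1}\right)S'_y,$$ where $S'_y=\{j:\gamma^j\in\operatorname{Span}(1,\gamma^y),\ 0\leq j\leq e'-1\}$, with $\gamma=\alpha^{(q^n-1)/(q^d-1)}$ and $e'=(q^d-1)/(q-1)$. Moreover: (a) $(0,0)_e=f-1$. (b) $(0,i)_e=(i,0)_e=(i,i)_e=0$ for all $1\leq i\leq e-1$. (c) For $1\leq j\leq e-1$ and $0\leq i\leq e-1$ with $i\notin\{0,j\}$, $(i,j)_e$ equals $1$ if $i\in S_j\setminus\{0,j\}$,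 and equals $0$ otherwise.
   Context: All spans are over $\mathrm{GF}(q)$. With $q^n=ef+1$, the cyclotomic classes of order $e$ are $C_i^e=\{\alpha^{es+i}:0\leq s\leq f-1\}$, $0\leq i\leq e-1$. The cyclotomic number $(i,j)_e$ is the number of pairs $(z_i,z_j)\in C_i^e\times C_j^e$ with $z_i=z_j-1$. For subsets $A,B$ of an additive group, $\Delta(A,B)$ is the multiset $\{x-y:x\in A,\ y\in B\}$; unions of classes are multiset unions. For $1\leq k\leq e-1$, $S_k=\{j:\alpha^j\in\operatorname{Span}(1,\alpha^k),\ 0\leq j\leq e-1\}\subseteq\mathbb{Z}_e$. A Singer difference set in $\mathbb{Z}_e$ corresponding to $\alpha$ is a set of the form $I=\{i\in\mathbb{Z}_e:\alpha^i\in H\}$, where $H$ is a $\mathrm{GF}(q)$-subspace of $\mathrm{GF}(q^n)$ of codimension $1$ (well defined since $\alpha^e\in\mathrm{GF}(q)^*$). For $m\in\mathbb{Z}_e$ and $A\subseteq\mathbb{Z}_e$, $m+A=\{m+a:a\in A\}$. For $g=(q^n-1)/(q^d-1)=e/e'$, $gS'_y=\{gj:j\in S'_y\}\subseteq\mathbb{Z}_e$, with elements of $S'_y$ represented by integers $0\leq j\leq e'-1$. *)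

(* Defs.v *)
From HB Require Import structures.
From mathcomp Require Import all_boot all_order all_algebra all_field.
From mathcomp Require Import finmap.

Set Implicit Arguments.
Unset Strict Implicit.
Unset Printing Implicit Defensive.

Import GRing.Theory.
Local Open Scope ring_scope.

(* Throughout, GF(q) is a finite field F and GF(q^n) is a field extension L    *)
(* of F with \dim {:L} = n. A vspace of L is thus a GF(q)-subspace, and a      *)
(* subfield of L is a subfield containing GF(q).                               *)

Definition cyclotomic_class (L : fieldType) (alpha : L) (e f i : nat) :
    {fset L} :=
  [fset alpha ^+ (e * s + i)%N | s in iota 0 f]%fset.

Definition cyclotomic_number (L : fieldType) (alpha : L) (e f i j : nat) :
    nat :=
  (let Ci := cyclotomic_class alpha e f i in
   let Cj := cyclotomic_class alpha e f j in
   #|` [fset z in Ci `*` Cj | z.1 == z.2 - 1%R] |)%fset.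

(* Multisets are represented by sequences, compared with perm_eq.              *)
Definition Delta (L : fieldType) (A B : {fset L}) : seq L :=
  [seq x - y | x <- A, y <- B].

Definition class_union (L : fieldType) (alpha : L) (e f : nat)
    (J : {set 'Z_e}) : seq L :=
  flatten [seq enum_fset (cyclotomic_class alpha e f j) | j : 'Z_e in J].

(* 'Z_m consists of the integers 0 <= j <= m - 1 only for 1 < m. Below, m is   *)
(* (q^n - 1) / (q - 1) or (q^d - 1) / (q - 1) with d > 1, hence at least 3.    *)
Definition span_set (F : fieldType) (L : fieldExtType F) (beta : L)
    (m k : nat) : {set 'Z_m} :=
  [set j : 'Z_m | beta ^+ j \in <<[:: 1; beta ^+ k]%R>>%VS].

Definition singer_difference_set (F : fieldType) (L : fieldExtType F)
    (alpha : L) (e : nat) (I : {set 'Z_e}) : Prop :=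
  exists2 H : {vspace L},
    (\dim H).+1 = \dim {:L} & I = [set i : 'Z_e | alpha ^+ i \in H].

Definition translate (e : nat) (m : 'Z_e) (A : {set 'Z_e}) : {set 'Z_e} :=
  [set m + a | a in A].

Definition dilate (g m e : nat) (A : {set 'Z_m}) : {set 'Z_e} :=
  [set ((g * j)%N)%:R | j : 'Z_m in A].
Arguments dilate g {m} e A.

(* The intersection of the translates - i k + I, 0 <= i <= n - 3.              *)
Definition singer_meet (n e k : nat) (I : {set 'Z_e}) : {set 'Z_e} :=
  \bigcap_(i < n - 2) translate (- ((i * k)%N)%:R) I.

(* Main.v *)
Require Import Defs.
From HB Require Import structures.
From mathcomp Require Import all_boot all_order all_algebra all_field.
From mathcomp Require Import finmap.
Set Implicit Arguments.
Unset Strict Implicit.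
Unset Printing Implicit Defensive.
Import GRing.Theory.
Local Open Scope ring_scope.

(** The field GF(q^n), taken modulo the scalars GF(q)^*, is a projective space
whose points are the e classes C_j: a nonzero x lies in C_j exactly when it is
a scalar multiple of alpha^j. Under j |-> C_j every subspace V is recorded by a
subset [points V] of Z_e, intersections of subspaces become intersections of
subsets, and multiplying V by alpha^-m translates the subset by -m. All the sets
in the theorem are such sets of points, so the theorem becomes linear algebra.

Differences. Put theta = alpha^k, which is not a scalar. An element of
Delta(C_k, C_0) is a theta - b with nonzero scalars a and b, and a, b are
determined by it because 1 and theta are independent. These are the elements of
Span(1, theta) off the two lines spanned by 1 and theta, each taken once
([Delta_class_union]). For i outside {0, j}, a solution of z_i = z_j - 1 puts a
multiple of alpha^i in that set; conversely alpha^i = a theta - b scales to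
exactly one solution ([cyclotomic_number_distinct]).

Singer sets. Let theta generate GF(q^n) and let H be a hyperplane. Let W_m be
the space of the v with v theta^i in H for all i < m. Each further condition
lowers the dimension by at most one. After n conditions v GF(q^n) is contained
in H, which forces v = 0; so every condition lowers the dimension by exactly one
and dim W_m = n - m. Hence W_(n-1) is a line, spanned by some w, and the plane
W_(n-2) contains w and w theta, so that W_(n-2) = w Span(1, theta)
([krylov_meet_span]). Taking points, W_(n-2) is the intersection of the
translates -ik + I, its intersection with theta^-1 W_(n-2) is W_(n-1), that is
the single point x, and dividing by w is translating by -x.

Subfields. A power alpha^m lies in GF(q^d) exactly when (q^n-1)/(q^d-1) divides
m ([alphaX_subfield], from x^(q^d) = x). If theta lies in GF(q^d), so does
Span(1, theta), and its points are read off from powers of gamma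
([span_set_subfield]). The case d = 1 says that alpha^m is a scalar exactly
when e divides m, which is what makes the C_j pairwise distinct points. *)

(** * Arithmetic of the number of points of a projective space *)

Lemma pred_dvdn_predX q d : (q - 1 %| q ^ d - 1)%N.
Proof. by rewrite !subn1 dvdn_pred_predX. Qed.

Lemma proj_card_gt1 q d : (1 < q)%N -> (1 < d)%N -> (1 < (q ^ d - 1) %/ (q - 1))%N.
Proof.
move=> q1 d1; have q1' : (0 < q - 1)%N by rewrite subn_gt0.
rewrite -(ltn_pmul2r q1') divnK ?pred_dvdn_predX // mul1n ltn_sub2r //.
  by rewrite -{1}[1%N](exp1n d) ltn_exp2r // ltnW.
by rewrite -{1}[q]expn1 ltn_exp2l.
Qed.

(** * Lines and cosets of subspaces in a field extension *)

Section VectorLines.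
Variables (F : fieldType) (L : fieldExtType F).
Implicit Types (x y z : L) (V : {vspace L}).

Lemma mem_line_div x y : y != 0 -> (x \in <[y]>%VS) = (x / y \in 1%VS).
Proof.
move=> y0; apply/vlineP/vlineP=> -[a h]; exists a.
  by rewrite h -scalerAl divff.
by rewrite -[x](divfK y0) h -scalerAl mul1r.
Qed.

Lemma mem_lineC x y : x != 0 -> y != 0 -> (x \in <[y]>%VS) = (y \in <[x]>%VS).
Proof.
move=> x0 y0; rewrite (mem_line_div x y0) (mem_line_div y x0).
have -> : y / x = (x / y)^-1 by rewrite invf_div.
exact/esym/(memvV 1%AS).
Qed.

(** A subspace contains a projective point as soon as it contains one nonzero
representative of it; this is what lets exponents be reduced modulo e. *)
Lemma memv_on_line V x y :
  x != 0 -> x \in <[y]>%VS -> (x \in V) = (y \in V).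
Proof.
move=> x0 /vlineP[a xE]; move: x0; rewrite xE scaler_eq0 negb_or rpredZeq.
by case/andP=> /negPf->.
Qed.

Lemma line_capv0 x y z :
  y != 0 -> y \notin <[x]>%VS -> z \in <[x]>%VS -> z \in <[y]>%VS -> z = 0.
Proof.
move=> y0 yx zx zy; apply: contraNeq yx => z0.
by rewrite -(memv_on_line _ z0 zy).
Qed.

Lemma mem_cosetV V x y : y != 0 -> (x \in (V * <[y^-1]>)%VS) = (x * y \in V).
Proof.
move=> y0; apply/memv_cosetP/idP => [[u uV ->]|xyV].
  by rewrite mulfVK.
by exists (x * y); rewrite ?mulfK.
Qed.

Lemma memv_bigcap (I : finType) (Vs : I -> {vspace L}) x :
  reflect (forall i, x \in Vs i) (x \in (\bigcap_i Vs i)%VS).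
Proof.
apply: (iffP subv_bigcapP) => h i; [exact: h|move=> _; exact: h].
Qed.

End VectorLines.

(** * Intersections of the translates of a hyperplane by powers of a generator *)

Section KrylovMeet.

Variables (F : fieldType) (L : fieldExtType F) (theta : L) (H : {vspace L}).
Hypothesis theta_gen : (<<1; theta>> = fullv :> {vspace L})%VS.
Hypothesis codimH : (\dim H).+1 = \dim {:L}.
Hypothesis dimL : (2 <= \dim {:L})%N.

Let theta_notin1 : theta \notin 1%VS.
Proof.
apply: contraL dimL => theta1; rewrite -theta_gen.
by rewrite (Fadjoin_idP (K := 1%AS) theta1) dimv1.
Qed.

Let theta_neq0 : theta != 0.
Proof. by apply: contraNneq theta_notin1 => ->; rewrite mem0v. Qed.

(** The annihilator of the Krylov sequence 1, theta, ..., theta^(m-1) under the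
pairing (u, v) |-> T(u v), where T is a linear form with kernel H. *)
Definition krylov_meet m : {vspace L} :=
  (\bigcap_(i < m) (H * <[(theta ^+ i)^-1]>))%VS.

Lemma mem_krylov_meet m x :
  reflect (forall i, (i < m)%N -> x * theta ^+ i \in H) (x \in krylov_meet m).
Proof.
apply: (iffP (memv_bigcap _ _)) => [h i im|h i].
  by have := h (Ordinal im); rewrite mem_cosetV ?expf_neq0.
by rewrite mem_cosetV ?expf_neq0 // h.
Qed.

(** The powers of theta of exponent less than the dimension span the whole
field, so a nonzero v in this space would make v L = L a subspace of H. *)
Lemma krylov_meet_dim_eq0 : krylov_meet (\dim {:L}) = 0%VS.
Proof.
apply/eqP; rewrite -subv0; apply/subvP=> x /mem_krylov_meet xH.
rewrite memv0; apply: contraT => x0.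
suff HE : H = fullv by have /eqP := codimH; rewrite HE eqn_leq ltnn.
apply/eqP; rewrite eqEsubv subvf /=; apply/subvP=> v _.
have := memvf (v / x); rewrite -theta_gen (Fadjoin_eq_sum 1%AS).
case/memv_sumP=> u uP /(canRL (divfK x0))->; rewrite mulr_suml.
apply: memv_suml => i _; have /memv_cosetP[_ /vlineP[c ->] ->] := uP i isT.
rewrite -scalerAl mul1r -scalerAl memvZ // mulrC xH //.
apply: leq_trans (ltn_ord i) _; have := dim_Fadjoin 1%AS theta.
by rewrite theta_gen dimv1 muln1 => ->.
Qed.

Lemma dim_krylov_meetS m : (\dim (krylov_meet m) <= (\dim (krylov_meet m.+1)).+1)%N.
Proof.
rewrite /krylov_meet big_ord_recr /= -/(krylov_meet m).
set U := (H * _)%VS; have dU : (\dim U).+1 = \dim {:L}.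
  by rewrite dim_cosetv ?invr_neq0 ?expf_neq0.
rewrite -(leq_add2r (\dim U)) -dimv_sum_cap addSnnS dU addnC leq_add2l.
exact/dimvS/subvf.
Qed.

(** The dimension starts at \dim {:L}, drops by at most one at each step, and
reaches 0 after \dim {:L} steps: no step can fail to drop it. *)
Lemma dim_krylov_meet m :
  (m <= \dim {:L})%N -> \dim (krylov_meet m) = (\dim {:L} - m)%N.
Proof.
have lo j : (\dim {:L} <= \dim (krylov_meet j) + j)%N.
  elim: j => [|j IH]; first by rewrite /krylov_meet big_ord0 addn0.
  by rewrite addnS -addSn; apply: leq_trans IH _; rewrite leq_add2r dim_krylov_meetS.
have hi j c : (\dim (krylov_meet j) <= \dim (krylov_meet (j + c)) + c)%N.
  elim: c => [|c IH]; first by rewrite !addn0.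
  by rewrite !addnS -addSn; apply: leq_trans IH _; rewrite leq_add2r dim_krylov_meetS.
move=> mn; apply/eqP; rewrite eqn_leq leq_subLR addnC lo andbT.
by apply: leq_trans (hi m (\dim {:L} - m)%N) _; rewrite subnKC // krylov_meet_dim_eq0 dimv0.
Qed.

Lemma krylov_meet_capV m :
  (krylov_meet m.+1 :&: (krylov_meet m.+1 * <[theta^-1]>) = krylov_meet m.+2)%VS.
Proof.
apply/vspaceP=> x; rewrite memv_cap mem_cosetV //.
apply/andP/mem_krylov_meet => [[/mem_krylov_meet h /mem_krylov_meet h']|h].
  by case=> [_|i im]; [exact: h|rewrite exprS mulrA h'].
split; apply/mem_krylov_meet => i im; first by rewrite h // ltnW.
by rewrite -mulrA -exprS h.
Qed.

Lemma dim_span1theta : \dim <<[:: 1; theta]%R>>%VS = 2%N.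
Proof.
rewrite span_cons span_seq1 dimv_disjoint_sum ?dim_vline ?oner_eq0 ?theta_neq0 //.
apply/eqP; rewrite -subv0; apply/subvP=> x; rewrite memv_cap => /andP[x1 xt].
by rewrite memv0; apply/eqP; apply: line_capv0 x1 xt.
Qed.

(** The vector w kills the powers of theta up to exponent n-2, so both w and
w theta kill those up to exponent n-3; comparing dimensions, they span the plane
of all vectors that do. *)
Lemma krylov_meet_span :
  exists2 w, w != 0 &
    krylov_meet (\dim {:L}).-1 = <[w]>%VS /\
    (krylov_meet (\dim {:L}).-2 * <[w^-1]> = <<[:: 1; theta]%R>>)%VS.
Proof.
move: dimL dim_krylov_meet; case dE: (\dim {:L}) => [|[|d]] //= _ dimW.
have {dimW} [d1 d2] : \dim (krylov_meet d.+1) = 1%N /\ \dim (krylov_meet d) = 2%N.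
  (* Here \dim {:L} = d.+2, and the two dimensions are d.+2 - d.+1, d.+2 - d. *)
  by rewrite !dimW // ?subSS ?subSn // ?subnn // ltnW.
pose w := vpick (krylov_meet d.+1).
have w0 : w != 0 by rewrite vpick0 -dimv_eq0 d1.
have wW : w \in krylov_meet d.+1 := memv_pick _.
exists w => //; split.
  by apply/esym/eqP; rewrite -dimv_leqif_eq ?dim_vline ?w0 ?d1 -?memvE.
apply/esym/eqP; rewrite -dimv_leqif_eq; last first.
  rewrite span_cons span_seq1 subv_add -!memvE !mem_cosetV // mul1r.
  move/mem_krylov_meet: wW => wH.
  apply/andP; split; apply/mem_krylov_meet => i im; first by rewrite wH // ltnW.
  by rewrite mulrAC -exprS mulrC wH.
by rewrite dim_span1theta dim_cosetv ?d2 // invr_neq0.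
Qed.

End KrylovMeet.

(** * Powers of the primitive element *)

Section Cyclotomy.

Variables (F : finFieldType) (L : fieldExtType F) (q n e f : nat).
Hypothesis hq : #|F| = q.
Hypothesis hn : \dim {:L} = n.
Hypothesis hn2 : (1 < n)%N.
Hypothesis he : e = ((q ^ n - 1) %/ (q - 1))%N.
Hypothesis hf : f = (q - 1)%N.
Variable alpha : L.
Hypothesis halpha : (q ^ n - 1)%N.-primitive_root alpha.

Lemma q_gt1 : (1 < q)%N. Proof. by rewrite -hq finNzRing_gt1. Qed.

Lemma f_gt0 : (0 < f)%N. Proof. by rewrite hf subn_gt0 q_gt1. Qed.

Lemma mul_ef : (e * f = q ^ n - 1)%N.
Proof. by rewrite he hf divnK // pred_dvdn_predX. Qed.

Lemma e_gt1 : (1 < e)%N.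
Proof. by rewrite he proj_card_gt1 ?q_gt1. Qed.

Lemma e_gt0 : (0 < e)%N. Proof. exact: ltnW e_gt1. Qed.

Lemma alpha_neq0 : alpha != 0.
Proof.
apply/eqP => a0; have /eqP := prim_expr_order halpha; rewrite a0 -mul_ef.
by rewrite expr0n muln_eq0 !eqn0Ngt e_gt0 f_gt0 /= eq_sym oner_eq0.
Qed.

Lemma alphaX_neq0 m : alpha ^+ m != 0.
Proof. exact: expf_neq0 alpha_neq0. Qed.
Local Hint Resolve alphaX_neq0 : core.

Lemma alpha_gen (x : L) : x != 0 -> exists m, x = alpha ^+ m.
Proof.
move=> x0; have := memvf x; rewrite Fermat's_little_theorem hq hn => /eqP xq.
case: (prim_rootP halpha (x := x)) => [|i ->]; last by exists i.
apply: (mulIf x0); rewrite -exprSr mul1r subn1 prednK ?xq //.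
by rewrite expn_gt0 ltnW // q_gt1.
Qed.

Lemma subfield_card_dvdn (K : {subfield L}) : (q ^ \dim K - 1 %| q ^ n - 1)%N.
Proof.
have /dvdnP[c nE] : (\dim K %| n)%N by rewrite -hn field_dimS ?subvf.
by rewrite nE mulnC expnM pred_dvdn_predX.
Qed.

(** GF(q^d) consists of the x with x^(q^d) = x, and alpha has order q^n - 1. *)
Lemma alphaX_subfield (K : {subfield L}) m :
  (alpha ^+ m \in K) = ((q ^ n - 1) %/ (q ^ \dim K - 1) %| m)%N.
Proof.
set Q := (q ^ \dim K)%N.
have Q1 : (1 < Q)%N by rewrite -{1}(expn0 q) ltn_exp2l ?q_gt1 ?adim_gt0.
have dvQ : (Q - 1 %| q ^ n - 1)%N := subfield_card_dvdn K.
rewrite Fermat's_little_theorem hq -/Q.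
rewrite -(prednK (ltnW Q1)) exprS -subn1 -{3}[alpha ^+ m]mulr1 (inj_eq (mulfI _)) //.
rewrite -exprM -(prim_order_dvd halpha) -{1}(divnK dvQ) dvdn_pmul2r ?subn_gt0 //.
by rewrite subSS subn0.
Qed.

Lemma alphaX_base m : (alpha ^+ m \in 1%VS) = (e %| m)%N.
Proof. by rewrite (alphaX_subfield 1%AS) dimv1 expn1 he. Qed.

(** The inverse of alpha^j is the power alpha^((e f - 1) j), which reduces the
claim to the membership of a power of alpha in the scalars. *)
Lemma alphaX_line i j : (alpha ^+ i \in <[alpha ^+ j]>%VS) = (i == j %[mod e]).
Proof.
set N := (e * f).-1.
have NS : N.+1 = (e * f)%N by rewrite prednK // muln_gt0 e_gt0 f_gt0.
have aV : (alpha ^+ j)^-1 = alpha ^+ (N * j).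
  apply: (mulfI (alphaX_neq0 j)); rewrite divff // -exprD -mulSn NS mul_ef.
  by rewrite exprM (prim_expr_order halpha) expr1n.
rewrite mem_line_div // aV -exprD alphaX_base -(eqn_modDr (N * j) i j).
by rewrite -mulSn NS -mulnA modnMr.
Qed.

(** * Subspaces as sets of points indexed by Z_e *)

Definition points (V : {vspace L}) : {set 'Z_e} :=
  [set i : 'Z_e | alpha ^+ i \in V].

Lemma val_natZ m : (m%:R : 'Z_e) = (m %% e)%N :> nat.
Proof. exact: val_Zp_nat e_gt1 m. Qed.

Lemma mem_points m V : (m%:R \in points V) = (alpha ^+ m \in V).
Proof.
rewrite inE val_natZ; apply: memv_on_line => //.
by rewrite alphaX_line modn_mod.
Qed.

Lemma natZ_eq i j : (i%:R == j%:R :> 'Z_e) = (i == j %[mod e]).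
Proof. by rewrite -val_eqE /= !val_natZ. Qed.

Lemma points_capv U V : points (U :&: V) = points U :&: points V.
Proof. by apply/setP=> i; rewrite !inE memv_cap. Qed.

Lemma points_bigcapv (J : finType) (Vs : J -> {vspace L}) :
  points (\bigcap_i Vs i) = \bigcap_i points (Vs i).
Proof.
apply/setP=> i; rewrite inE; apply/memv_bigcap/bigcapP => h j.
  by rewrite inE.
by have:= h j isT; rewrite inE.
Qed.

Lemma points_line (x : 'Z_e) : points <[alpha ^+ x]> = [set x].
Proof.
apply/setP=> i; rewrite !inE alphaX_line -natZ_eq; congr (_ == _); exact: natr_Zp.
Qed.

Lemma translate_points m V :
  translate (- m%:R) (points V) = points (V * <[(alpha ^+ m)^-1]>).
Proof.
apply/setP=> j; rewrite [RHS]inE mem_cosetV // -exprD -mem_points natrD natr_Zp.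
apply/imsetP/idP => [[a aV ->]|h]; first by rewrite addrAC addNr add0r.
by exists (j + m%:R) => //; rewrite addrC addrK.
Qed.

(** * Cyclotomic classes and their differences *)

(** C_i is a projective point without the origin: the powers of alpha^e are all
the nonzero scalars. *)
Lemma mem_cyclotomic_class i x :
  (x \in cyclotomic_class alpha e f i) = (x != 0) && (x \in <[alpha ^+ i]>%VS).
Proof.
apply/imfsetP/andP => [[s _ ->]|[x0]].
  by rewrite alphaX_line mulnC modnMDl.
rewrite mem_line_div // => hx.
have [m mE] : exists m, x / alpha ^+ i = alpha ^+ m.
  by apply: alpha_gen; rewrite mulf_neq0 // invr_neq0.
move: hx; rewrite mE alphaX_base => /dvdnP[s sE].
(* alpha^e has order f, so its exponent can be brought below f. *)
exists (s %% f)%N; first by rewrite /= mem_iota /= add0n ltn_mod f_gt0.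
rewrite -(divfK (alphaX_neq0 i) x) mE exprD; congr (_ * _).
apply/eqP; rewrite (eq_prim_root_expr halpha) -mul_ef sE.
by rewrite mulnC -!muln_modr modn_mod.
Qed.

Lemma card_cyclotomic_class i : #|` cyclotomic_class alpha e f i|%fset = f.
Proof.
rewrite card_in_imfset /= ?undup_id ?iota_uniq ?size_iota //.
move=> s t; rewrite /= !mem_iota /= !add0n => sf tf /eqP.
rewrite (eq_prim_root_expr halpha) -mul_ef eqn_modDr -!muln_modr.
by rewrite eqn_pmul2l ?e_gt0 // !modn_small // => /eqP.
Qed.

Lemma mem_Delta i j z :
  reflect (exists2 x, (x != 0) && (x \in <[alpha ^+ i]>%VS) &
           exists2 y, (y != 0) && (y \in <[alpha ^+ j]>%VS) & z = x - y)
  (z \in Delta (cyclotomic_class alpha e f i) (cyclotomic_class alpha e f j)).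
Proof.
apply: (iffP allpairsP) => [[[x y] /= []]|[x hx [y hy ->]]].
  by rewrite !mem_cyclotomic_class => hx hy ->; exists x => //; exists y.
by exists (x, y); rewrite /= !mem_cyclotomic_class.
Qed.

Lemma mem_class_union m (J : {set 'Z_e}) :
  (alpha ^+ m \in class_union alpha f J) = (m%:R \in J).
Proof.
apply/flatten_mapP/idP => [[j]|mJ].
  rewrite mem_enum mem_cyclotomic_class alphaX_line -natZ_eq => jJ /andP[_].
  by move/eqP->; rewrite natr_Zp.
exists (m%:R : 'Z_e); first by rewrite mem_enum.
rewrite mem_cyclotomic_class alphaX_line alphaX_neq0 //= -natZ_eq.
by apply/eqP/esym/natr_Zp.
Qed.

Lemma class_union_uniq (J : {set 'Z_e}) : uniq (class_union alpha f J).
Proof.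
(* The inner identity map gives flatten the shape of a dependent allpairs. *)
rewrite /class_union -[X in flatten X](eq_map (fun j => map_id _)).
apply: (allpairs_uniq_dep (T := fun=> L)); rewrite ?enum_uniq //.
  by move=> j _; apply: fset_uniq.
move=> _ _ /allpairsPdep[i [x [_ xi ->]]] /allpairsPdep[j [y [_ yj ->]]] /= xy.
move: xi yj; rewrite -{y}xy !mem_cyclotomic_class => /andP[x0 xi] /andP[_ xj].
suff -> : i = j by [].
move: xj; rewrite (memv_on_line _ x0 xi) alphaX_line -natZ_eq !natr_Zp.
by move/eqP.
Qed.

Section Line.

Variable k : nat.
Hypothesis hk : ~~ (e %| k)%N.

Let theta := alpha ^+ k.

Let theta_notin1 : theta \notin 1%VS.
Proof. by rewrite alphaX_base. Qed.

Let base_notin_theta : 1 \notin <[theta]>%VS.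
Proof. by rewrite mem_lineC ?oner_eq0 ?alphaX_neq0. Qed.

(** If a theta - b = a' theta - b', the difference (a - a') theta = b - b' lies
on two distinct lines, hence vanishes. *)
Lemma Delta_uniq :
  uniq (Delta (cyclotomic_class alpha e f k) (cyclotomic_class alpha e f 0)).
Proof.
apply: allpairs_uniq; try exact: fset_uniq.
move=> _ _ /allpairsP[[x y] /= [xC yC ->]] /allpairsP[[x' y'] /= [x'C y'C ->]] /= E.
move: xC yC x'C y'C; rewrite !mem_cyclotomic_class expr0.
move=> /andP[_ xk] /andP[_ y1] /andP[_ x'k] /andP[_ y'1].
have E' : x - x' = y - y'.
  by apply/eqP; rewrite subr_eq addrAC -addrA addrC -subr_eq E.
have x0 : x - x' = 0.
  apply: (line_capv0 (alphaX_neq0 k) theta_notin1); last exact: memvB.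
  by rewrite E' memvB.
by rewrite -(subr0_eq x0) -(@subr0_eq _ y y') // -E'.
Qed.

Lemma mem_Delta_span z :
  (z \in Delta (cyclotomic_class alpha e f k) (cyclotomic_class alpha e f 0))
  = [&& z \in <<[:: 1; theta]%R>>%VS, z \notin 1%VS & z \notin <[theta]>%VS].
Proof.
rewrite span_cons span_seq1; apply/mem_Delta/and3P.
  case=> x /andP[x0 xk] [y /andP[y0 y1] ->]; rewrite expr0 in y1; split.
  - by apply/memv_addP; exists (- y); rewrite ?memvN //; exists x; rewrite // addrC.
  - by rewrite rpredBr // (memv_on_line _ x0 xk).
  - by rewrite rpredBl // (memv_on_line _ y0 y1).
case=> /memv_addP[y y1 [x xk ->]] h1 hk'.
exists x.
  by rewrite xk andbT; apply: contraNneq h1 => ->; rewrite addr0.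
exists (- y); last by rewrite opprK addrC.
rewrite expr0 memvN y1 andbT oppr_eq0.
by apply: contraNneq hk' => ->; rewrite add0r.
Qed.

Lemma mem_span_setD m :
  (m%:R \in span_set alpha e k :\: [set 0; k%:R]) =
  [&& alpha ^+ m \in <<[:: 1; theta]%R>>%VS, alpha ^+ m \notin 1%VS
    & alpha ^+ m \notin <[theta]>%VS].
Proof.
rewrite in_setD in_set2 negb_or andbC; congr (_ && (~~ _ && ~~ _)).
- exact: mem_points.
- by rewrite -[0]/(0%:R) natZ_eq alphaX_base mod0n.
- by rewrite natZ_eq alphaX_line.
Qed.

Lemma Delta_class_union :
  perm_eq (Delta (cyclotomic_class alpha e f k) (cyclotomic_class alpha e f 0))
    (class_union alpha f (span_set alpha e k :\: [set 0; k%:R])).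
Proof.
apply: uniq_perm; [exact: Delta_uniq|exact: class_union_uniq|move=> z].
have [->|/alpha_gen[m ->]] := eqVneq z 0.
  rewrite mem_Delta_span !mem0v /=; apply/esym/flatten_mapP => -[j _].
  by rewrite mem_cyclotomic_class eqxx.
by rewrite mem_class_union mem_Delta_span mem_span_setD.
Qed.

(** A solution z_i = z_j - 1 is an element of Delta(C_k, C_0), with j = k, whose
subtrahend is normalised to 1. Writing alpha^i = x - y with x in C_k and y a
scalar, division by y gives a solution; two solutions differ by a vector common
to the distinct lines of alpha^i and alpha^k, hence agree. *)
Lemma cyclotomic_number_distinct i :
  ~~ (e %| i)%N -> (i%:R : 'Z_e) != k%:R ->
  cyclotomic_number alpha e f i k =
    (if (i%:R : 'Z_e) \in span_set alpha e k :\: [set 0; k%:R] then 1%N else 0%N).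
Proof.
move=> i0 ik; rewrite /cyclotomic_number; set A := [fset z in _ | _]%fset.
have memA z : (z \in A) = [&& z.1 != 0, z.1 \in <[alpha ^+ i]>%VS, z.2 != 0,
    z.2 \in <[theta]>%VS & z.1 == z.2 - 1].
  by rewrite !inE /= !mem_cyclotomic_class -!andbA.
have ik' : alpha ^+ i \notin <[theta]>%VS by rewrite alphaX_line -natZ_eq.
case: ifPn => [|iS].
  rewrite mem_span_setD -mem_Delta_span => /mem_Delta[x /andP[x0 xk]].
  case=> y /andP[y0]; rewrite expr0 => y1 E.
  suff -> : A = [fset (alpha ^+ i / y, x / y)]%fset by rewrite cardfs1.
  (* y is a scalar, so dividing by it moves no vector out of a subspace. *)
  have divy z (V : {vspace L}) : (z / y \in V) = (z \in V).
    have [->|z0] := eqVneq z 0; first by rewrite mul0r.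
    apply: memv_on_line; first by rewrite mulf_neq0 ?invr_neq0.
    by rewrite mem_line_div // mulrAC divff // mul1r (memvV 1%AS).
  have yV : (alpha ^+ i / y, x / y) \in A.
    rewrite memA /= !divy xk memv_line !mulf_neq0 ?invr_neq0 ?alphaX_neq0 //=.
    by rewrite E mulrBl divff.
  apply/fsetP => -[u v]; rewrite in_fset1; apply/idP/eqP => [uvA|-> //].
  move: uvA yV; rewrite !memA /= => /and5P[u0 ui v0 vk /eqP uE].
  move: (alpha ^+ i / y) (x / y) => u' v' /and5P[u'0 u'i v'0 v'k /eqP u'E].
  have E' : u - u' = v - v' by rewrite uE u'E opprB addrA subrK.
  have h0 : u - u' = 0.
    apply: (line_capv0 (alphaX_neq0 i) ik'); last exact: memvB.
    by rewrite E' memvB.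
  by rewrite (subr0_eq h0) (@subr0_eq _ v v') // -E'.
apply/eqP; rewrite cardfs_eq0; apply: contraNT iS => /fset0Pn[[u v]].
rewrite memA /= => /and5P[u0 ui v0 vk /eqP uE].
rewrite mem_span_setD -!(memv_on_line _ u0 ui) -mem_Delta_span.
apply/mem_Delta; exists v; first by rewrite v0.
by exists 1 => //; rewrite oner_eq0 expr0 memv_line.
Qed.

(** In the three degenerate cases the equation z_i = z_j - 1 would make the lines
of 1 and of alpha^k coincide. *)
Lemma cyclotomic_number0k : cyclotomic_number alpha e f 0 k = 0%N.
Proof.
apply/eqP; rewrite cardfs_eq0; apply/fset0Pn => -[[u v]].
rewrite !inE /= !mem_cyclotomic_class expr0.
case/andP=> /andP[/andP[_ u1] /andP[v0 vk]] /eqP uE.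
by case/negP: theta_notin1; rewrite -(memv_on_line _ v0 vk) -(subrK 1 v) -uE
  memvD ?memv_line.
Qed.

Lemma cyclotomic_numberk0 : cyclotomic_number alpha e f k 0 = 0%N.
Proof.
apply/eqP; rewrite cardfs_eq0; apply/fset0Pn => -[[u v]].
rewrite !inE /= !mem_cyclotomic_class expr0.
case/andP=> /andP[/andP[u0 uk] /andP[_ v1]] /eqP uE.
by case/negP: theta_notin1; rewrite -(memv_on_line _ u0 uk) uE memvB ?memv_line.
Qed.

Lemma cyclotomic_numberkk : cyclotomic_number alpha e f k k = 0%N.
Proof.
apply/eqP; rewrite cardfs_eq0; apply/fset0Pn => -[[u v]].
rewrite !inE /= !mem_cyclotomic_class.
case/andP=> /andP[/andP[_ uk] /andP[_ vk]] /eqP uE.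
case/negP: base_notin_theta; rewrite (_ : 1 = v - u) ?memvB //.
by rewrite uE opprB addrC subrK.
Qed.

End Line.

(** The solutions are the pairs (x - 1, x) with x a scalar other than 0 and 1. *)
Lemma cyclotomic_number00 : cyclotomic_number alpha e f 0 0 = (f - 1)%N.
Proof.
set C := cyclotomic_class alpha e f 0.
have C1 : 1 \in C by rewrite /C mem_cyclotomic_class oner_eq0 expr0 memv_line.
have <- : #|` C `\ 1|%fset = (f - 1)%N.
  by rewrite -(card_cyclotomic_class 0) (cardfsD1 1 C) C1 addKn.
transitivity #|` [fset (x - 1, x) | x in C `\ 1%R]|%fset; last first.
  by rewrite card_imfset // => x y [].
congr #|` _|%fset; apply/fsetP => -[u v].
rewrite !inE /= /C !mem_cyclotomic_class expr0.
apply/andP/imfsetP => /= [[/andP[/andP[u0 u1] /andP[v0 v1]] /eqP uE]|[x + [-> ->]]].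
  exists v; last by rewrite uE.
  by rewrite !inE /= /C mem_cyclotomic_class expr0 v0 v1 !andbT -subr_eq0 -uE.
rewrite !inE /= /C mem_cyclotomic_class expr0 subr_eq0 => /and3P[-> -> x1].
by rewrite x1 memvB ?memv_line.
Qed.

(** * Description of the sets S_k *)

Lemma singer_meet_points k H :
  singer_meet n k (points H) = points (krylov_meet (alpha ^+ k) H (n - 2)).
Proof.
rewrite /singer_meet /krylov_meet points_bigcapv; apply: eq_bigr => i _.
by rewrite translate_points mulnC exprM.
Qed.

Lemma span_set_singer k (I : {set 'Z_e}) :
  (3 <= n)%N -> singer_difference_set alpha I ->
  (forall K : {subfield L}, (\dim K %| n)%N -> (\dim K < n)%N ->
     alpha ^+ k \notin K) ->
  let X := singer_meet n k I in
  exists2 x : 'Z_e,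
    X :&: translate (- k%:R) X = [set x] & span_set alpha e k = translate (- x) X.
Proof.
move=> hn3 [H codimH ->] gen; rewrite /= -/(points H) singer_meet_points.
(* The subfield generated by alpha^k cannot be proper, as it contains alpha^k. *)
have theta_gen : (<<1; alpha ^+ k>> = fullv :> {vspace L})%VS.
  have dv : (\dim <<1; alpha ^+ k>> %| n)%N.
    by rewrite -hn (field_dimS (F := <<1; alpha ^+ k>>%AS)) ?subvf.
  apply/eqP; rewrite -dimv_leqif_eq ?subvf // hn eqn_leq dvdn_leq ?(ltnW hn2) //=.
  rewrite leqNgt; apply/negP => lt.
  by have /negP[] := gen <<1; alpha ^+ k>>%AS dv lt; rewrite memv_adjoin.
have dim2 : (2 <= \dim {:L})%N by rewrite hn.
have [w w0 []] := krylov_meet_span theta_gen codimH dim2.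
case: (alpha_gen w0) => m ->; rewrite hn -subn2 -subn1 => line coset.
exists m%:R.
  rewrite translate_points -points_capv.
  have -> : (n - 2 = (n - 3).+1)%N by rewrite -subSn // subSS.
  rewrite krylov_meet_capV //.
  have -> : ((n - 3).+2 = n - 1)%N by rewrite -!subSn ?subSS // leqW.
  rewrite line -points_line; congr (points _); apply/eqP.
  by rewrite eqEsubv -!memvE !alphaX_line val_natZ !modn_mod eqxx.
by rewrite translate_points coset.
Qed.

(** Span(1, alpha^k) lies in K, whose nonzero elements are the powers of
gamma = alpha^g; as e = g e', multiplication by g carries residues modulo e'
to residues modulo e. *)
Lemma span_set_subfield k y (K : {subfield L}) (d := \dim K)
    (g := ((q ^ n - 1) %/ (q ^ d - 1))%N) (e' := ((q ^ d - 1) %/ (q - 1))%N) :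
  (1 < d)%N -> alpha ^+ k = alpha ^+ (y * g) ->
  span_set alpha e k = dilate g e (span_set (alpha ^+ g) e' y).
Proof.
move=> d1 ky.
have e'1 : (1 < e')%N by apply: proj_card_gt1; rewrite ?q_gt1.
have eE : e = (g * e')%N.
  apply/eqP; rewrite -(eqn_pmul2r f_gt0) mul_ef -mulnA hf.
  by rewrite divnK ?pred_dvdn_predX // divnK // subfield_card_dvdn.
have gK m : (alpha ^+ m \in K) = (g %| m)%N by rewrite alphaX_subfield.
have span_sub : (<<[:: 1; alpha ^+ k]%R>> <= K)%VS.
  by rewrite span_cons span_seq1 subv_add -!memvE mem1v ky gK dvdn_mull.
apply/setP=> j; rewrite inE; apply/idP/imsetP => [jS|[i + ->]].
  have /dvdnP[i jE] : (g %| j)%N by rewrite -gK (subvP span_sub).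
  exists (i%:R : 'Z_e'); last first.
    rewrite val_Zp_nat //; apply/eqP.
    by rewrite -[j]natr_Zp natZ_eq jE eE (mulnC i) muln_modr modn_mod.
  rewrite inE -!exprM ![(g * _)%N]mulnC -ky val_Zp_nat //.
  suff h : alpha ^+ (i %% e' * g) \in <[alpha ^+ j]>%VS.
    by rewrite (memv_on_line _ _ h) // alphaX_neq0.
  by rewrite alphaX_line jE eE (mulnC g e') muln_modl modn_mod.
have := mem_points (g * i) <<[:: 1; alpha ^+ k]%R>>%VS; rewrite inE => ->.
by rewrite inE ky (mulnC y) !exprM.
Qed.

End Cyclotomy.

(** * Differences of classes and cyclotomic numbers of order e *)

Theorem theorem3p16 (F : finFieldType) (L : fieldExtType F) (q n e f : nat)
    (hq : #|F| = q) (hn : \dim {:L} = n) (hn3 : (3 <= n)%N)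
    (he : e = ((q ^ n - 1) %/ (q - 1))%N) (hf : f = (q - 1)%N)
    (alpha : L) (halpha : (q ^ n - 1)%N.-primitive_root alpha)
    (I : {set 'Z_e}) (hI : singer_difference_set alpha I) :
  (forall k : nat, (1 <= k <= e - 1)%N ->
     let S := span_set alpha e k in
     [/\ perm_eq
           (Delta (cyclotomic_class alpha e f k) (cyclotomic_class alpha e f 0))
           (class_union alpha f (S :\: [set 0; k%:R])),
         (forall (d : nat) (K : {subfield L}),
            (d %| n)%N -> (d < n)%N -> \dim K = d -> alpha ^+ k \notin K) ->
         let X := singer_meet n k I in
         exists2 x : 'Z_e,
           X :&: translate (- k%:R) X = [set x] & S = translate (- x) X
       & forall (d : nat) (K : {subfield L}),
           (1 < d)%N -> (d %| n)%N -> \dim K = d -> alpha ^+ k \in K ->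
           let g := ((q ^ n - 1) %/ (q ^ d - 1))%N in
           let gamma := alpha ^+ g in
           let e' := ((q ^ d - 1) %/ (q - 1))%N in
           (exists y : nat, alpha ^+ k = alpha ^+ (y * g)) /\
           (forall y : nat, alpha ^+ k = alpha ^+ (y * g) ->
              S = dilate g e (span_set gamma e' y))]) /\
  [/\ cyclotomic_number alpha e f 0 0 = (f - 1)%N,
      forall i : nat, (1 <= i <= e - 1)%N ->
        [/\ cyclotomic_number alpha e f 0 i = 0%N,
            cyclotomic_number alpha e f i 0 = 0%N
          & cyclotomic_number alpha e f i i = 0%N]
    & forall i j : nat, (1 <= j <= e - 1)%N -> (0 <= i <= e - 1)%N ->
        i \notin [:: 0%N; j] ->
        cyclotomic_number alpha e f i j =
          (if (i%:R : 'Z_e) \in span_set alpha e j :\: [set 0; j%:R]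
           then 1%N else 0%N)].
Proof.
have hn2 : (1 < n)%N := ltnW hn3.
have e1 := e_gt1 hq hn2 he.
have notdvd m : (1 <= m <= e - 1)%N -> ~~ (e %| m)%N.
  by case/andP=> m0 me; rewrite gtnNdvd // -(subnK (ltnW e1)) addn1.
split=> [k /notdvd hk S|].
  split.
  - exact: (Delta_class_union hq hn hn2 he hf halpha hk).
  - move=> gen; apply: (span_set_singer hq hn hn2 he hf halpha hn3 hI) => K dv lt.
    exact: gen dv lt (erefl _).
  - move=> d K d1 _ dK kK; rewrite -dK => g gamma e'.
    rewrite -dK in d1; split; last first.
      by move=> y; exact: (span_set_subfield hq hn hn2 he hf halpha).
    move: kK; rewrite (alphaX_subfield hq hn hn2 he hf halpha) => /dvdnP[y ->].
    by exists y.
split; first exact: (cyclotomic_number00 hq hn hn2 he hf halpha).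
  move=> i /notdvd hi; split.
  - exact: (cyclotomic_number0k hq hn hn2 he hf halpha hi).
  - exact: (cyclotomic_numberk0 hq hn hn2 he hf halpha hi).
  - exact: (cyclotomic_numberkk hq hn hn2 he hf halpha hi).
move=> i j hj hi; rewrite in_cons mem_seq1 negb_or => /andP[i0 ij].
have lt_e m : (m <= e - 1)%N -> (m < e)%N by rewrite subn1 -ltnS prednK // ltnW.
case/andP: hi => _ /lt_e ie; case/andP: (hj) => _ /lt_e je.
apply: (cyclotomic_number_distinct hq hn hn2 he hf halpha (notdvd _ hj)).
  by rewrite gtnNdvd // lt0n.
by rewrite (natZ_eq hq hn2 he) !modn_small.
Qed.
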